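(* Let $n\ge 2$ be an integer, let $E=\{e\subseteq [n]: |e|=2\}$ and $m=|E|=\binom n2$. Then the polynomial $$f_3(x)=\sum_{(e_1,e_2,e_3)\in E^3}\ \prod_{i=1}^3\frac{x_{e_i}}{|e_1\cup\cdots\cup e_i|}$$ in the variables $x=(x_e)_{e\in E}$ is convex on the standard simplex $\Delta_m$.
   Context: $[n]=\{1,\ldots,n\}$. The standard simplex is $\Delta_m=\{x=(x_e)_{e\in E}\in\mathbb R^m: x_e\ge 0 \text{ for all } e\in E,\ \sum_{e\in E}x_e=1\}$. *)

(* Defs.v *)
From HB Require Import structures.
From mathcomp Require Import all_boot all_order all_algebra.
From mathcomp Require Import all_classical all_reals.
From mathcomp Require Import convex.

Set Implicit Arguments.
Unset Strict Implicit.
Unset Printing Implicit Defensive.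

Import Order.TTheory GRing.Theory Num.Theory.

Local Open Scope classical_set_scope.
Local Open Scope ring_scope.

(* The 2-element subsets of the ground set, which is 'I_n = {0, .., n-1}
   instead of {1, .., n}. *)
Definition edge (n : nat) : finType := {e : {set 'I_n} | #|e| == 2%N}.

Fact card_edge (n : nat) : #|{: edge n}| = 'C(n, 2).
Proof.
rewrite card_sig -[n in RHS]card_ord -cardsT -(cards_draws [set: 'I_n]%SET 2) cardsE.
by apply: eq_card => e; rewrite !inE unfold_in /= finset.subsetT.
Qed.

(* The regular module R^o gives {ffun E -> R^o} its R-module structure. *)
Definition std_simplex (R : realType) (E : finType) : set {ffun E -> R^o} :=
  [set x | (forall e, 0 <= x e) /\ \sum_e x e = 1].

(* Tuples are indexed from 0, so the i-th denominator is the size of the union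
   of the entries of index 0, .., i, the i-th one included. *)
Definition edge_poly (R : realType) (n k : nat)
    (x : {ffun edge n -> R^o}) : R^o :=
  \sum_(s : k.-tuple (edge n)) \prod_(i < k)
    (x (tnth s i) / #|(\bigcup_(j < k | (j <= i)%N) val (tnth s j))%SET|%:R).

(* Main.v *)
Require Import Defs.
From mathcomp Require Import all_boot all_order all_algebra.
From mathcomp Require Import all_classical all_reals.
From mathcomp Require Import convex.
From mathcomp Require Import interval_inference zify ring lra.

(** The sum of the coefficient of x_e x_f x_g over cyclic rotations is
  symmetric, so f_3(x) = (1/6) sum K(e,f,g) x_e x_f x_g with
  K(e,f,g) = (1/|e+f| + 1/|f+g| + 1/|g+e|) / |e+f+g| (+ denoting union).
  A cubic form with symmetric coefficients is convex on the nonnegative orthant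
  as soon as every slice K(e,.,.) is positive semidefinite.  For e = {a,b} the
  value K(e,f,g) depends only on which of a, b lie in f and in g and on
  d = |(f & g) - e|; separating the part constant in d, the part linear in d
  and the diagonal, and completing squares in each, writes K(e,.,.) as a
  combination of positive semidefinite kernels with positive coefficients that
  do not depend on n. *)

Set Implicit Arguments.
Unset Strict Implicit.
Unset Printing Implicit Defensive.

Import Order.TTheory GRing.Theory Num.Theory.
Local Open Scope ring_scope.

Definition psd_kernel (R : numDomainType) (T : finType) (k : T -> T -> R) :=
  forall u : T -> R, 0 <= \sum_f \sum_g k f g * (u f * u g).

Section PsdKernel.
Variables (R : realDomainType) (T : finType).
Implicit Types (k h : T -> T -> R) (v : T -> R).

Lemma psd_kernelD k h :
  psd_kernel k -> psd_kernel h -> psd_kernel (fun f g => k f g + h f g).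
Proof.
move=> pk ph u; under eq_bigr do under eq_bigr do rewrite mulrDl.
under eq_bigr do rewrite big_split.
by rewrite big_split addr_ge0.
Qed.

Lemma psd_kernelZ (c : R) k :
  0 <= c -> psd_kernel k -> psd_kernel (fun f g => c * k f g).
Proof.
move=> c0 pk u; under eq_bigr do under eq_bigr do rewrite -mulrA.
under eq_bigr do rewrite -mulr_sumr.
by rewrite -mulr_sumr mulr_ge0.
Qed.

Lemma psd_kernel_sum (I : finType) (k : I -> T -> T -> R) :
  (forall i, psd_kernel (k i)) -> psd_kernel (fun f g => \sum_i k i f g).
Proof.
move=> pk u; under eq_bigr do under eq_bigr do rewrite mulr_suml.
under eq_bigr do rewrite exchange_big.
by rewrite exchange_big sumr_ge0// => i _; apply: pk.
Qed.

Lemma psd_kernel_rank1 v : psd_kernel (fun f g => v f * v g).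
Proof.
move=> u; under eq_bigr do under eq_bigr do rewrite mulrACA.
under eq_bigr do rewrite -mulr_sumr.
by rewrite -mulr_suml -expr2 sqr_ge0.
Qed.

Lemma psd_kernel_diag v :
  (forall f, 0 <= v f) -> psd_kernel (fun f g => (f == g)%:R * v f).
Proof.
move=> v0 u; apply: sumr_ge0 => f _; rewrite (bigD1 f)//= eqxx mul1r.
rewrite big1 ?addr0 => [|g /negPf]; first by rewrite mulr_ge0 -?expr2 ?sqr_ge0.
by rewrite eq_sym => ->; rewrite !mul0r.
Qed.

End PsdKernel.

(** The cardinality counts points [i] outside [D] lying in both sets, and each such point
    contributes the product of two indicators, hence a rank-one kernel. *)
Lemma psd_kernel_card_setI (R : realDomainType) (U T : finType) (D : {set U})
    (A : T -> {set U}) (v : T -> R) :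
  psd_kernel (fun f g => #|(A f :&: A g) :\: D|%SET%:R * (v f * v g)).
Proof.
pose w i f := ((i \notin D) && (i \in A f))%:R * v f.
suff -> : (fun f g => #|(A f :&: A g) :\: D|%SET%:R * (v f * v g)) =
          (fun f g => \sum_i w i f * w i g).
  by apply: psd_kernel_sum => i; apply: psd_kernel_rank1.
apply/funext => f; apply/funext => g.
rewrite -sum1_card natr_sum mulr_suml big_mkcond; apply: eq_bigr => i _.
rewrite /w !inE; case: (i \in D) => /=; first by rewrite !mul0r.
by case: (i \in A f); case: (i \in A g); rewrite /= ?(mul0r, mulr0, mul1r).
Qed.

Section TripleSum.
Variables (R : comPzRingType) (T : finType).
Implicit Types F G : T -> T -> T -> R.

Definition sum3 F := \sum_e \sum_f \sum_g F e f g.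

Lemma eq_sum3 F G : (forall e f g, F e f g = G e f g) -> sum3 F = sum3 G.
Proof. by move=> FG; do 3![apply: eq_bigr => ? _]. Qed.

Lemma sum3D F G : sum3 (fun e f g => F e f g + G e f g) = sum3 F + sum3 G.
Proof.
rewrite /sum3 -big_split; apply: eq_bigr => e _; rewrite -big_split.
by apply: eq_bigr => f _; rewrite -big_split.
Qed.

Lemma sum3Z c F : sum3 (fun e f g => c * F e f g) = c * sum3 F.
Proof.
rewrite /sum3 mulr_sumr; apply: eq_bigr => e _; rewrite mulr_sumr.
by apply: eq_bigr => f _; rewrite mulr_sumr.
Qed.

Lemma sum3_rot F : sum3 F = sum3 (fun e f g => F f g e).
Proof.
rewrite /sum3 [RHS]exchange_big.
by under [RHS]eq_bigr do rewrite exchange_big.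
Qed.

(** Rotating the bound variables preserves the sum, so two triple sums can be compared triple by
    triple once their summands are replaced by their cyclic sums. *)
Lemma sum3_cyc F :
  sum3 F *+ 3 = sum3 (fun e f g => F e f g + F f g e + F g e f).
Proof.
rewrite !sum3D -sum3_rot -(sum3_rot (fun e f g => F f g e)) -sum3_rot.
by rewrite mulrS mulr2n addrA.
Qed.

End TripleSum.

Lemma sum_tuple3 (R : pzSemiRingType) (T : finType) (F : 3.-tuple T -> R) :
  \sum_s F s = \sum_e \sum_f \sum_g F [tuple e; f; g].
Proof.
under [RHS]eq_bigr do rewrite pair_big /=.
rewrite pair_big /= (reindex (fun p : T * (T * T) => [tuple p.1; p.2.1; p.2.2])) //=.
pose h (s : 3.-tuple T) : T * (T * T) :=
  let s1 := behead_tuple s in (thead s, (thead s1, thead (behead_tuple s1))).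
exists h => [[e [f g]] _ | s _] //.
case/tupleP: s => e s; case/tupleP: s => f s; case/tupleP: s => g s.
by apply: val_inj; rewrite /= !theadE; case: (s) => -[].
Qed.

Section ConvexCubic.
Variables (R : realFieldType) (T : finType) (K : T -> T -> T -> R).

Definition cubic (x : T -> R) := sum3 (fun e f g => K e f g * (x e * x f * x g)).

(* With [y := a - b], the defect of convexity of the cubic form is
   [t (1 - t)] times its polarization at [((1 + t) a + (2 - t) b, y, y)]. *)
Lemma cubic_convex (t : R) (a b : T -> R) :
  (forall e f g, K e f g = K f g e) -> (forall e, psd_kernel (K e)) ->
  0 <= t <= 1 -> (forall e, 0 <= a e) -> (forall e, 0 <= b e) ->
  cubic (fun e => t * a e + (1 - t) * b e) <= t * cubic a + (1 - t) * cubic b.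
Proof.
move=> Krot Kpsd /andP[t0 t1] a0 b0.
pose y e := a e - b e; pose w e := (1 + t) * a e + (2 - t) * b e.
pose P := sum3 (fun e f g => K e f g * (w e * (y f * y g))).
(* Each [e] contributes the weight [w e >= 0] times the quadratic form of the slice [K e] at [y],
   whose entries may have any sign. *)
have P0 : 0 <= P.
  apply: sumr_ge0 => e _.
  under eq_bigr do under eq_bigr do rewrite mulrCA.
  under eq_bigr do rewrite -mulr_sumr.
  rewrite -mulr_sumr mulr_ge0 ?Kpsd // addr_ge0 // mulr_ge0 //; lra.
suff E : t * cubic a + (1 - t) * cubic b
         - cubic (fun e => t * a e + (1 - t) * b e) = t * (1 - t) * P.
  by rewrite -subr_ge0 E mulr_ge0 // mulr_ge0 // subr_ge0.
have {}E : t * cubic a + (1 - t) * cubic b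
    + (- 1) * cubic (fun e => t * a e + (1 - t) * b e)
    + (- (t * (1 - t))) * P = 0.
  rewrite /cubic /P -!sum3Z -!sum3D.
  (* The summands do not vanish individually, since [w] singles out the first index. Their cyclic
     sums do: [Krot] makes [K e f g] a common factor of a polynomial that is identically zero. *)
  apply: (@pmulrnI _ 3) => //; rewrite mul0rn sum3_cyc.
  rewrite /sum3 big1 // => e _; rewrite big1 // => f _; rewrite big1 // => g _.
  by rewrite -(Krot e f g) (Krot g e f) /y /w; ring.
by lra.
Qed.

End ConvexCubic.

Section EdgeKernel.
Variables (R : realFieldType) (n : nat).
Implicit Types e f g : edge n.

Definition edge_kernel e f g : R :=
  (#|val e :|: val f|%SET%:R^-1 + #|val f :|: val g|%SET%:R^-1
   + #|val g :|: val e|%SET%:R^-1) / #|val e :|: val f :|: val g|%SET%:R.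

Lemma edge_kernel_rot e f g : edge_kernel e f g = edge_kernel f g e.
Proof.
rewrite /edge_kernel; congr (_ / _); first by rewrite [RHS]addrC addrA.
by rewrite [in RHS]finset.setUC finset.setUA.
Qed.

End EdgeKernel.

(** With [e] equal to [[set a; b]], this reduces every cardinality in the kernel to membership bits
    and a count outside [e]. *)
Lemma card_pairE (U : finType) (a b : U) (A : {set U}) : a != b ->
  #|A| = ((a \in A) + (b \in A) + #|A :\: [set a; b]|)%SET%N.
Proof.
move=> ab; rewrite (cardsD1 a A) (cardsD1 b (A :\ a)%SET) !inE eq_sym ab /= addnA.
by rewrite finset.setDDl.
Qed.

(* [z], [P], [W] are the indicators of [#|f :&: e|] being 2, 1, 0, and [s] is
   antisymmetric in [a] and [b]. *)
Lemma edge_kernelE (R : realFieldType) (n : nat) (a b : 'I_n) (e f g : edge n) :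
  a != b -> val e = [set a; b]%SET ->
  let A (f : edge n) : R := (a \in val f)%:R in let B (f : edge n) : R := (b \in val f)%:R in
  let z (f : edge n) : R := A f * B f in let W (f : edge n) : R := (1 - A f) * (1 - B f) in
  let P (f : edge n) : R := 1 - z f - W f in let s (f : edge n) : R := A f - B f in
  let l (f : edge n) : R := W f + 4 / 3 * P f + 2 * z f in
  let p (f : edge n) : R := P f + 16 / 5 * z f in
  let q (f : edge n) : R := P f + 18 / 35 * W f in
  let d : R := #|(val f :&: val g) :\: val e|%SET%:R in
  edge_kernel R e f g =
    1 / 8 * (l f * l g) + 5 / 288 * (p f * p g) + 13 / 180 * (z f * z g)
    + 1 / 96 * (s f * s g)
    + 35 / 288 * (d * (q f * q g)) + 1 / 105 * (d * (W f * W g))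
    + 5 / 288 * (d * (s f * s g)) + 1 / 24 * ((f == g)%:R * W f).
Proof.
move=> ab Ee A B z W P s l p q d.
(* Equality of edges also becomes a condition on cardinalities, so that the whole identity is
   numerical. *)
have fg : (f == g) = (#|val f :&: val g|%SET == 2%N).
  have F2 := eqP (valP f); have G2 := eqP (valP g).
  apply/eqP/eqP => [->|I2]; first by rewrite finset.setIid.
  apply/val_inj/eqP; rewrite eqEcard G2 F2 leqnn andbT.
  by apply/finset.setIidPl/eqP; rewrite eqEcard I2 F2 finset.subsetIl.
have := eqP (valP f); have := eqP (valP g).
have := cardsUI (val f :\: val e)%SET (val g :\: val e)%SET.
rewrite -finset.setDUl -finset.setDIl fg /edge_kernel /d Ee {d}.
have -> : ([set a; b] :|: val f :|: val g = [set a; b] :|: (val f :|: val g))%SET.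
  by rewrite finset.setUA.
rewrite (finset.setUC (val g)).
have cU (X : {set 'I_n}) : (#|[set a; b] :|: X| = 2 + #|X :\: [set a; b]|)%SET%N.
  rewrite (card_pairE _ ab) !inE !eqxx orbT /=.
  by rewrite finset.setDUl finset.setDv finset.set0U.
rewrite !cU (card_pairE (val f) ab) (card_pairE (val g) ab).
rewrite (card_pairE (val f :&: val g)%SET ab) (card_pairE (val f :|: val g)%SET ab).
rewrite !inE /l /p /q /s /P /z /W /A /B {l p q s P z W A B}.
have : (#|(val f :&: val g) :\: [set a; b]| <= #|val f :\: [set a; b]|)%SET%N.
  by rewrite subset_leq_card // finset.setSD // finset.subsetIl.
have : (#|(val f :&: val g) :\: [set a; b]| <= #|val g :\: [set a; b]|)%SET%N.
  by rewrite subset_leq_card // finset.setSD // finset.subsetIr.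
move: #|(val f :&: val g) :\: _|%SET #|(val f :|: val g) :\: _|%SET
  #|val f :\: _|%SET #|val g :\: _|%SET => d u F G.
move=> dG dF ud eG eF.
(* Inclusion-exclusion outside [e]; the truncated subtraction is exact because [d <= F]. *)
have {ud}-> : u = (F + G - d)%N by lia.
have EF : F = (2 - ((a \in val f) + (b \in val f)))%N by lia.
have EG : G = (2 - ((a \in val g) + (b \in val g)))%N by lia.
move: dG dF; rewrite {}EF {}EG => {eF eG F G}.
(* Since [d] is at most [F] and [G], hence at most 2, finitely many cases remain. The value [d = 2]
   means that [f = g] is disjoint from [e]: there the part affine in [d] gives 5/24, and the
   diagonal term supplies the 1/24 missing from the kernel value 1/4. *)
case: (a \in val f); case: (b \in val f); case: (a \in val g); case: (b \in val g);
  case: d => [|[|[|d]]] // _ _; rewrite /= /addn /= /subn /=; by field.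
Qed.

Lemma edge_kernel_psd (R : realFieldType) (n : nat) (e : edge n) :
  psd_kernel (edge_kernel R e).
Proof.
have /cards2P[a [b [ab Ee]]] := valP e.
move=> u; under eq_bigr do under eq_bigr do rewrite (edge_kernelE R _ _ ab Ee).
move: u; do ![apply: psd_kernelD | apply: psd_kernelZ; first lra].
1-4: exact: psd_kernel_rank1.
1-3: exact: psd_kernel_card_setI.
by apply: psd_kernel_diag => f; rewrite mulr_ge0 // subr_ge0 lern1 leq_b1.
Qed.

(** The factor 6 is 2 times 3: the first denominator is the size 2 of an edge, and averaging over
    the three rotations divides by 3. *)
Lemma edge_poly3E (R : realType) (n : nat) (x : {ffun edge n -> R^o}) :
  edge_poly 3 x = 6^-1 * cubic (@edge_kernel R n) x.
Proof.
pose c (e f g : edge n) : R := x e / 2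
  * (x f / #|val e :|: val f|%SET%:R)
  * (x g / #|val e :|: val f :|: val g|%SET%:R).
have -> : edge_poly 3 x = sum3 c.
  rewrite /edge_poly sum_tuple3; apply: eq_sum3 => e f g.
  rewrite !big_ord_recl big_ord0 mulr1 mulrA.
  do 3!rewrite big_mkcond !big_ord_recl big_ord0 /=.
  by rewrite /c !(tnth_nth e) /= !finset.setU0 (eqP (valP e)) finset.setUA.
apply: (@pmulrnI _ 3) => //; rewrite sum3_cyc /= -mulrnAr /cubic sum3_cyc -sum3Z.
apply: eq_sum3 => e f g.
rewrite -(edge_kernel_rot R e f g) (edge_kernel_rot R g e f) /edge_kernel /c.
have -> : (val f :|: val g :|: val e = val e :|: val f :|: val g)%SET.
  by rewrite finset.setUC finset.setUA.
have -> : (val g :|: val e :|: val f = val e :|: val f :|: val g)%SET.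
  by rewrite -finset.setUA finset.setUC.
(* With the reciprocals taken as atoms, [field] does not ask for the cardinalities to be nonzero. *)
move: (#|val e :|: val f :|: val g|%SET%:R^-1) (#|val e :|: val f|%SET%:R^-1)
  (#|val f :|: val g|%SET%:R^-1) (#|val g :|: val e|%SET%:R^-1) => p q r s.
by field.
Qed.

Theorem mainTheorem4 (R : realType) (n : nat) (hn : (2 <= n)%N) :
  convex_function (@std_simplex R (edge n)) (@edge_poly R n 3).
Proof.
move=> t x y /set_mem[x0 _] /set_mem[y0 _].
have t01 : 0 <= t%:num <= (1 : R) by rewrite ge0 le1.
have := cubic_convex (@edge_kernel_rot R n) (@edge_kernel_psd R n) t01 x0 y0.
have -> : (fun e => t%:num * x e + (1 - t%:num) * y e) = conv t x y
    :> (edge n -> R).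
  by apply/funext => e; rewrite !ffunE.
by rewrite !edge_poly3E -(ler_pM2l (x := 6^-1)) ?invr_gt0 // mulrDr !(mulrCA 6^-1).
Qed.
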